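(* Let $i\in[N]$, let $(t_1,t_2)\in A^{\rm temporal}$, let $J=[t_1,t_2-1]$ be the associated cyclic interval of $\hat T$ periods, and let $s_{it_1}\in\mathbb{Z}_{\ge 0}$. Let $(\pi^*_{\hat t},\boldsymbol\lambda^*_{\hat t})_{\hat t\in J\cup\{0\}}$ be an optimal solution of problem (LOP) given in the context, and define the discrete distribution, supported on at most $\hat T+1$ points, $$\mathbb{P}^*=\sum_{\hat t\in J\cup\{0\},\ \pi^*_{\hat t}\ne0}\pi^*_{\hat t}\,\delta_{\boldsymbol\lambda^*_{\hat t}/\pi^*_{\hat t}},$$ where $\delta_{\boldsymbol\zeta'}$ is the Dirac distribution placing unit mass on the demand realization $\boldsymbol\zeta'$ of the demands $(\zeta^i_t)_{t\in J}$. Then: (i) $\mathbb{P}^*\in\mathcal{P}$, in the sense that $\mathbb{P}^*$ is a probability distribution of $(\zeta^i_t)_{t\in J}$ satisfying the support, mean and mean-absolute-deviation conditions defining $\mathcal{P}$ for all the coordinates $t\in J$ of retailer $i$; (ii) $$\mathbb{E}_{\mathbb{P}^*}\Bigl[h\sum_{t\in J}\bigl(s_{it_1}-\sum_{t'\in[t_1,t]}\zeta^i_{t'}\bigr)^+ + b\sum_{t\in J}\bigl(s_{it_1}-\sum_{t'\in[t_1,t]}\zeta^i_{t'}\bigr)^-\Bigr]=f^{\rm inv}(i,t_1,t_2,s_{it_1}).$$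
   Context: Let $N,T\ge1$ be integers, $[n]=\{1,\dots,n\}$, and $A^{\rm temporal}\subseteq[T]\times[T]$. Periods are cyclic: period $T$ is followed by period $1$. For $(t_1,t_2)\in A^{\rm temporal}$ put $\hat T=t_2-t_1$ if $t_2>t_1$ and $\hat T=t_2+T-t_1$ otherwise (so $1\le\hat T\le T$). The cyclic interval $J=[t_1,t_2-1]$ is the ordered sequence of $\hat T$ consecutive periods $t_1,t_1+1,\dots$ (wrapping around from $T$ to $1$ if needed) ending in the predecessor of $t_2$. For $t,\hat t\in J$: $[t_1,t]$ is the set of periods of $J$ from $t_1$ up to and including $t$ in this order; $[t_1,\hat t)$ is the set of periods of $J$ strictly before $\hat t$; $[\hat t,t_2-1]$ is the set of periods of $J$ from $\hat t$ (included) to the end. The index $0$ is an extra symbol not in $J$. Empty sums are $0$. For $x\in\mathbb{R}$: $x^+=\max\{x,0\}$, $x^-=\max\{-x,0\}$. $h,b\ge0$ are the per-unit holding and backorder costs. For $i\in[N]$, $t\in[T]$ the data are reals with $0\le\underline\zeta^i_t<\mu^i_t<\bar\zeta^i_t$ and $\sigma^i_t\ge0$. The ambiguity set $\mathcal{P}$ is the set of all probability distributions $\mathbb{P}$ of the random demand vector $\boldsymbol\zeta=(\zeta^i_t)_{i\in[N],t\in[T]}$ such that for all $i\in[N]$, $t\in[T]$: $\mathbb{P}(\zeta^i_t\in[\underline\zeta^i_t,\bar\zeta^i_t])=1$ (real interval), $\mathbb{E}_{\mathbb{P}}[\zeta^i_t]=\mu^i_t$, and $\mathbb{E}_{\mathbb{P}}[|\zeta^i_t-\mu^i_t|]\le\sigma^i_t$.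 No other condition (in particular no independence) is imposed on members of $\mathcal{P}$. The worst-case interval inventory cost is $$f^{\rm inv}(i,t_1,t_2,s)=\sup_{\mathbb{P}\in\mathcal{P}}\mathbb{E}_{\mathbb{P}}\Bigl[h\sum_{t\in J}\bigl(s-\sum_{t'\in[t_1,t]}\zeta^i_{t'}\bigr)^+ + b\sum_{t\in J}\bigl(s-\sum_{t'\in[t_1,t]}\zeta^i_{t'}\bigr)^-\Bigr].$$ Problem (LOP), for given $i,t_1,t_2,s_{it_1}$, has variables $\pi_{\hat t}\in\mathbb{R}_+$ and $\boldsymbol\lambda_{\hat t}=(\lambda_{\hat t t})_{t\in J}\in\mathbb{R}^{\hat T}$ for $\hat t\in J\cup\{0\}$, and reads: maximize $$\sum_{\hat t\in J}\Bigl(h\sum_{t\in[t_1,\hat t)}\bigl(\pi_{\hat t}s_{it_1}-\sum_{t'\in[t_1,t]}\lambda_{\hat t t'}\bigr)+b\sum_{t\in[\hat t,t_2-1]}\bigl(\sum_{t'\in[t_1,t]}\lambda_{\hat t t'}-\pi_{\hat t}s_{it_1}\bigr)\Bigr)+h\sum_{t\in J}\bigl(\pi_0s_{it_1}-\sum_{t'\in[t_1,t]}\lambda_{0t'}\bigr)$$ subject to: $\sum_{\hat t\in J\cup\{0\}}\pi_{\hat t}=1$; $\sum_{\hat t\in J\cup\{0\}}\lambda_{\hat t t}=\mu^i_t$ for all $t\in J$; $\sum_{\hat t\in J\cup\{0\}}|\lambda_{\hat t t}-\pi_{\hat t}\mu^i_t|\le\sigma^i_t$ for all $t\in J$; $\pi_{\hat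 t}\underline\zeta^i_t\le\lambda_{\hat t t}\le\pi_{\hat t}\bar\zeta^i_t$ for all $t\in J$, $\hat t\in J\cup\{0\}$; $\sum_{t\in[t_1,\hat t)}\lambda_{\hat t t}\le\pi_{\hat t}s_{it_1}\le\sum_{t\in[t_1,\hat t]}\lambda_{\hat t t}$ for all $\hat t\in J$; $\sum_{t\in J}\lambda_{0t}\le\pi_0s_{it_1}$. *)

(* Defs.v *)
From HB Require Import structures.
From mathcomp Require Import all_boot all_order all_algebra.
From mathcomp Require Import all_classical all_reals all_analysis.

Set Implicit Arguments.
Unset Strict Implicit.
Unset Printing Implicit Defensive.
Import Order.TTheory GRing.Theory Num.Theory.

Local Open Scope classical_set_scope.
Local Open Scope ring_scope.

(* Periods 1, .., T are encoded as 'I_T (shifted by one).  The cyclic interval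
   J = [t1, t2 - 1] is encoded by positions: k : 'I_(interval_length t1 t2)
   stands for the period [period t1 k], so that the order of J is the order of
   the positions, [t1, t] is {l | l <= k} and [t1, t) is {l | l < k}, where k
   is the position of t.  J together with the extra index 0 is
   option 'I_(interval_length t1 t2), with None for the index 0. *)
Definition interval_length T (t1 t2 : 'I_T) : nat :=
  if (t1 < t2)%N then (t2 - t1)%N else (t2 + T - t1)%N.

(* [ordS] is the cyclic successor on 'I_T. *)
Definition period T (t1 : 'I_T) (k : nat) : 'I_T := iter k (@ordS T) t1.

Definition inv_cost (R : realType) (h b s : R) n (d : 'I_n -> R) : R :=
  h * \sum_(k < n) Num.max (s - \sum_(l < n | (l <= k)%N) d l) 0
  + b * \sum_(k < n) Num.max (- (s - \sum_(l < n | (l <= k)%N) d l)) 0.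

Definition support_mean_mad d (Omega : measurableType d) (R : realType)
    (P : probability Omega R) (X : Omega -> R) (zlo mu zhi sigma : R) : Prop :=
  [/\ P (X @^-1` `[zlo, zhi]) = 1%E,
      'E_P[X]%E = mu%:E
    & ('E_P[(fun w => `|X w - mu|%R)] <= sigma%:E)%E].

(* The demand vector of all retailers and periods; the nested tuple type
   carries the product of the Borel sigma-algebras. *)
Definition demands (R : realType) (N T : nat) := N.-tuple (T.-tuple R).

Definition demand (R : realType) (N T : nat) (i : 'I_N) (t : 'I_T)
  (z : demands R N T) : R := tnth (tnth z i) t.

Definition ambiguity_set (R : realType) (N T : nat)
    (zlo mu zhi sigma : 'I_N -> 'I_T -> R) :
    set (probability (demands R N T) R) :=
  [set P | forall i t, support_mean_mad P (@demand R N T i t)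
                         (zlo i t) (mu i t) (zhi i t) (sigma i t)].

Definition f_inv (R : realType) (N T : nat)
    (zlo mu zhi sigma : 'I_N -> 'I_T -> R) (h b : R)
    (i : 'I_N) (t1 t2 : 'I_T) (s : R) : \bar R :=
  ereal_sup
    [set 'E_P[(fun z => inv_cost h b s
                (fun k : 'I_(interval_length t1 t2) =>
                   demand i (period t1 k) z))]%E
    | P in ambiguity_set zlo mu zhi sigma].

(* Same conditions as in [ambiguity_set], for a distribution of the demands of
   retailer i in the periods of J only. *)
Definition ambiguity_set_on (R : realType) (N T : nat)
    (zlo mu zhi sigma : 'I_N -> 'I_T -> R) (i : 'I_N) (t1 t2 : 'I_T) :
    set (probability ((interval_length t1 t2).-tuple R) R) :=
  [set P | forall k : 'I_(interval_length t1 t2),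
     let t := period t1 k in
     support_mean_mad P (fun x => tnth x k)
       (zlo i t) (mu i t) (zhi i t) (sigma i t)].

Section LOP.
Context (R : realType) (N T : nat) (zlo mu zhi sigma : 'I_N -> 'I_T -> R).
Context (h b : R) (i : 'I_N) (t1 t2 : 'I_T) (s : R).
Let n := interval_length t1 t2.
Implicit Types (pi : option 'I_n -> R) (lambda : option 'I_n -> 'I_n -> R).

Definition lop_objective pi lambda : R :=
  \sum_(j < n)
    (h * \sum_(k < n | (k < j)%N)
           (pi (Some j) * s - \sum_(l < n | (l <= k)%N) lambda (Some j) l)
     + b * \sum_(k < n | (j <= k)%N)
           (\sum_(l < n | (l <= k)%N) lambda (Some j) l - pi (Some j) * s))
  + h * \sum_(k < n) (pi None * s - \sum_(l < n | (l <= k)%N) lambda None l).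

Definition lop_feasible pi lambda : Prop :=
  [/\ (forall j, 0 <= pi j) /\ \sum_j pi j = 1,
      forall k : 'I_n, \sum_j lambda j k = mu i (period t1 k),
      forall k : 'I_n,
        \sum_j `|lambda j k - pi j * mu i (period t1 k)|
          <= sigma i (period t1 k),
      forall (k : 'I_n) (j : option 'I_n),
        pi j * zlo i (period t1 k) <= lambda j k
          <= pi j * zhi i (period t1 k)
    & (forall j : 'I_n,
         \sum_(k < n | (k < j)%N) lambda (Some j) k <= pi (Some j) * s
           <= \sum_(k < n | (k <= j)%N) lambda (Some j) k)
      /\ \sum_(k < n) lambda None k <= pi None * s].

Definition lop_optimal pi lambda : Prop :=
  lop_feasible pi lambda /\
  forall pi' lambda', lop_feasible pi' lambda' ->
    lop_objective pi' lambda' <= lop_objective pi lambda.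

End LOP.

Definition discrete_distribution (R : realType) (n : nat)
    (pi : option 'I_n -> R) (lambda : option 'I_n -> 'I_n -> R) :
    set (n.-tuple R) -> \bar R :=
  fun A => (\sum_(j : option 'I_n | pi j != 0%R)
              (pi j)%:E * \d_[tuple (lambda j k / pi j)%R | k < n] A)%E.

(* Main.v *)
(* Partition the demand realizations by the first period j at which cumulative
   demand exceeds the stock s (None if there is none); on each cell the cost is
   a linear function of the demand.  For P in the ambiguity set, the
   probabilities pi_j of the cells and the integrals lambda_j of the demand over
   the cells are feasible for (LOP), with objective value E_P[cost]; hence
   f_inv is at most the optimal value.  Conversely the cost dominates each of
   the linear functions, so its expectation under P* is at least the optimal
   value, and P* extends to a member of the ambiguity set, so that this
   expectation is at most f_inv. *)
Require Import Defs.
From HB Require Import structures.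
From mathcomp Require Import all_boot all_order all_algebra.
From mathcomp Require Import zify lra.
From mathcomp Require Import all_classical all_reals all_analysis.
From mathcomp Require Import measurable_realfun.
Import Order.TTheory GRing.Theory Num.Theory.
Local Open Scope classical_set_scope.
Local Open Scope ring_scope.

(** * Finitely supported distributions and their expectations *)

Lemma finite_mixture {R : realType} {d} {Omega : measurableType d}
    {I : finType} (w : I -> R) (x : I -> Omega) :
  (forall j, 0 <= w j) -> \sum_j w j = 1 ->
  exists P : probability Omega R,
    (P = (fun A => \sum_j (w j)%:E * \d_(x j) A)%E :> (set Omega -> \bar R))
    /\ forall f : Omega -> R, measurable_fun setT f ->
         'E_P[f]%E = (\sum_j w j * f (x j))%:E.
Proof.
move=> w0 w1.
(* Weights summing to 1 force [I] to be inhabited; [j0] is only the default of [nth] in the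
   enumeration of [I] by which [msum] is indexed. *)
have [j0 _] : exists j0 : I, true.
  apply/existsP; apply: contraPT w1 => /existsPn noI.
  by rewrite big_pred0 => [/esym/eqP|j]; [rewrite oner_eq0|have := noI j].
pose r := enum I; pose y k := nth j0 r k.
pose m k : {measure set Omega -> \bar R} :=
  mscale (NngNum (w0 (y k))) (dirac (x (y k))).
have sum_enum (V : nmodType) (F : I -> V) :
    \sum_(k < size r) F (y k) = \sum_j F j.
  by rewrite -[RHS]big_enum (big_nth j0) big_mkord.
have mE A : msum m (size r) A = (\sum_j (w j)%:E * \d_(x j) A)%E.
  by rewrite /msum -(sum_enum _ (fun j => (w j)%:E * \d_(x j) A)%E).
have m1 : msum m (size r) setT = 1%E.
  by rewrite mE -w1 -sumEFin; apply: eq_bigr => j _; rewrite diracT mule1.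
pose isP := Measure_isProbability.Build _ _ _ (msum m (size r)) m1.
pose P : probability Omega R := HB.pack (msum m (size r)) isP.
have intE (g : Omega -> \bar R) : measurable_fun setT g ->
    (forall t, 0 <= g t)%E ->
    (\int[P]_t g t = \sum_j (w j)%:E * g (x j))%E.
  move=> mg g0.
  rewrite ge0_integral_measure_sum//.
  rewrite -(sum_enum _ (fun j => (w j)%:E * g (x j))%E).
  apply: eq_bigr => k _.
  by rewrite ge0_integral_mscale//= integral_dirac// diracT mul1e.
exists P; split; first exact/funext/mE.
move=> f mf.
have mEf : measurable_fun setT (EFin \o f) by exact/measurable_EFinP.
(* [intE] covers nonnegative functions, so it is applied to the positive and negative parts of [f],
   which are recombined at each atom. *)
rewrite unlock integralE !intE//;
  [|exact: measurable_funeneg|exact: measurable_funepos].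
rewrite funerpos funerneg /=.
under eq_bigr do rewrite -EFinM.
under [X in (_ - X)%E]eq_bigr do rewrite -EFinM.
rewrite !sumEFin -EFinB -sumrB; congr EFin; apply: eq_bigr => j _.
by rewrite -mulrBr -[f in RHS]funrposBneg.
Qed.

Lemma sum_option {V : nmodType} {I : finType} (F : option I -> V) :
  \sum_j F j = F None + \sum_i F (Some i).
Proof.
rewrite (bigD1 None)//= (reindex_omap Some id) => [|[]//].
by under eq_bigl do rewrite /= eqxx.
Qed.

(** * Stock-out cells and the linear cost on each of them *)

Section Cells.
Context {R : realType} {n : nat}.
Implicit Types (v : 'I_n -> R) (h b s p : R) (j : option 'I_n) (k : 'I_n).

(* The index j stands for the first period with a stock-out, None meaning that
   there is none. *)
Definition before j k : bool := if j is Some i then (k < i)%N else true.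

Definition in_cell s v j : bool :=
  (\sum_(k < n | before j k) v k <= s)
  && (if j is Some i then s < \sum_(k < n | (k <= i)%N) v k else true).

(** The weight [p] makes the cost homogeneous: [p = 1] gives the affine cost on cell [j], while
    [pi j] and [lambda j] give the term of index [j] in the objective of (LOP). *)
Definition cell_cost h b s j p v : R :=
  \sum_(k < n) (if before j k then h * (p * s - \sum_(l < n | (l <= k)%N) v l)
                else b * (\sum_(l < n | (l <= k)%N) v l - p * s)).

Lemma cell_costZ h b s j c p v :
  cell_cost h b s j (c * p) (fun k => c * v k) = c * cell_cost h b s j p v.
Proof.
rewrite /cell_cost mulr_sumr; apply: eq_bigr => k _.
by rewrite -mulr_sumr; case: ifP => _; rewrite -mulrA -mulrBr mulrCA.
Qed.

Lemma inv_costE h b s v :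
  inv_cost h b s v =
  \sum_(k < n) (h * Num.max (s - \sum_(l < n | (l <= k)%N) v l) 0
               + b * Num.max (- (s - \sum_(l < n | (l <= k)%N) v l)) 0).
Proof. by rewrite /inv_cost !mulr_sumr big_split. Qed.

(** As h and b are nonnegative, h x^+ + b x^- is at least h x and at least - b x, whichever of the
    two [j] selects in a period. *)
Lemma cell_cost_le_inv_cost h b s v j : 0 <= h -> 0 <= b ->
  cell_cost h b s j 1 v <= inv_cost h b s v.
Proof.
move=> h0 b0; rewrite inv_costE; apply: ler_sum => k _; rewrite mul1r.
set x := \sum_(l < n | _) _.
have max0 (z : R) : 0 <= Num.max z 0 by rewrite le_max lexx orbT.
have maxl (z : R) : z <= Num.max z 0 by rewrite le_max lexx.
case: ifP => _.
  by rewrite ler_wpDr ?mulr_ge0// ler_wpM2l.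
by rewrite ler_wpDl ?mulr_ge0// ler_wpM2l// opprB.
Qed.

(** Nonnegative demand makes cumulative demand nondecreasing, so the inequalities defining the cell
    fix the sign of the stock level in every period. *)
Lemma inv_cost_in_cell h b s v j : (forall k, 0 <= v k) -> in_cell s v j ->
  inv_cost h b s v = cell_cost h b s j 1 v.
Proof.
move=> v0 /andP[lo hi]; rewrite inv_costE; apply: eq_bigr => k _; rewrite mul1r.
have subsum (P Q : pred 'I_n) : subpred P Q ->
    \sum_(l < n | P l) v l <= \sum_(l < n | Q l) v l.
  move=> PQ; rewrite big_mkcond [leRHS]big_mkcond; apply: ler_sum => l _.
  by case: ifPn => [/PQ ->//|_]; case: ifP.
set x := \sum_(l < n | _) _; case: ifPn => jk.
  have xs : x <= s.
    apply: le_trans lo; apply: subsum => l lk.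
    by case: j jk {hi} => //= i; exact: leq_ltn_trans.
  by rewrite (max_idPl _) ?subr_ge0// (max_idPr _) ?mulr0 ?addr0// opprB subr_le0.
have sx : s <= x.
  case: j jk {lo} hi => //= i; rewrite -leqNgt => ik /ltW /le_trans; apply.
  by apply: subsum => l /leq_trans; apply.
by rewrite opprB (max_idPr _) ?subr_le0// (max_idPl _) ?mulr0 ?add0r// subr_ge0.
Qed.

(** With [D m] the demand of the first [m] periods and [A m] the indicator of [D m <= s],
    monotonicity of [D] makes cell [Some i] contribute [A i - A i.+1] and cell [None] contribute
    [A n]; the sum telescopes to [A 0], which is 1 since [s] is nonnegative. *)
Lemma sum_in_cell s v : 0 <= s -> (forall k, 0 <= v k) ->
  \sum_j (in_cell s v j)%:R = 1 :> R.
Proof.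
move=> s0 v0; pose D m := \sum_(k < n | (k < m)%N) v k.
have DS m : D m <= D m.+1.
  rewrite /D big_mkcond [leRHS]big_mkcond; apply: ler_sum => l _.
  by case: ifPn => [/ltnW lm|_]; [rewrite ltnS lm|case: ifP].
have D0 : D 0 = 0 by rewrite /D big_pred0.
have Dn : D n = \sum_(k < n | before None k) v k.
  by apply: eq_bigl => k; rewrite ltn_ord.
rewrite sum_option {1}/in_cell andbT -Dn.
pose A m : R := (D m <= s)%R%:R.
rewrite (eq_bigr (fun i : 'I_n => - A i.+1 - - A i)) => [|i _]; last first.
  rewrite /in_cell /= -/(D i) -[\sum_(k < n | (k <= i)%N) _]/(D i.+1) ltNge opprK.
  rewrite /A; have := DS i; case: (leP (D i.+1) s) => [Ds /le_trans->//|_ _].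
    by rewrite /= addNr.
  by rewrite andbT oppr0 add0r.
rewrite -(big_mkord xpredT (fun i => - A i.+1 - - A i)).
by rewrite (telescope_sumr (fun i => - A i))// /A D0 s0 opprK addrA subrr add0r.
Qed.

End Cells.

Lemma lop_objectiveE {R : realType} (T : nat) (h b : R) (t1 t2 : 'I_T) (s : R)
    (pi : option 'I_(interval_length t1 t2) -> R) lambda :
  lop_objective h b s pi lambda
  = \sum_j cell_cost h b s j (pi j) (lambda j).
Proof.
rewrite [in RHS]sum_option [RHS]addrC /lop_objective; congr +%R.
  apply: eq_bigr => j _; rewrite /cell_cost /= !mulr_sumr.
  rewrite [RHS](bigID (fun k : 'I__ => (k < j)%N)) /=.
  congr (_ + _); first by apply: eq_bigr => k ->.
  by apply: eq_big => k; rewrite ltnNge ?negbK// => ->.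
by rewrite mulr_sumr.
Qed.

(** * Calculus of finite expectations *)

Section Means.
Context {d : measure_display} {Omega : measurableType d} {R : realType}.
Variable P : probability Omega R.
Implicit Types (f g : Omega -> R) (q r : R).

(** Integrability is bundled with the value so that linearity and monotonicity compose without side
    conditions. *)
Definition has_mean f r : Prop :=
  P.-integrable setT (EFin \o f) /\ 'E_P[f]%E = r%:E.

Lemma has_mean_cst r : has_mean (cst r) r.
Proof.
split; last exact: expectation_cst.
exact: finite_measure_integrable_cst.
Qed.

Lemma has_meanD f g q r :
  has_mean f q -> has_mean g r -> has_mean (fun t => f t + g t) (q + r).
Proof.
move=> [fi fq] [gi gr]; split; first exact: (integrableD measurableT fi gi).
by move: fq gr; rewrite unlock EFinD => <- <-; exact: integralD_EFin.
Qed.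

Lemma has_meanZ c f r : has_mean f r -> has_mean (fun t => c * f t) (c * r).
Proof.
move=> [fi fr]; split; first exact: (integrableZl measurableT c fi).
by move: fr; rewrite unlock EFinM => <-; exact: (integralZl measurableT fi).
Qed.

Lemma has_meanB f g q r :
  has_mean f q -> has_mean g r -> has_mean (fun t => f t - g t) (q - r).
Proof.
move=> fq /(has_meanZ (-1)); rewrite mulN1r.
under eq_fun do rewrite mulN1r.
exact: has_meanD.
Qed.

Lemma has_mean_sum (I : Type) (s : seq I) (Q : pred I) (F : I -> Omega -> R)
    (m : I -> R) : (forall i, has_mean (F i) (m i)) ->
  has_mean (fun t => \sum_(i <- s | Q i) F i t) (\sum_(i <- s | Q i) m i).
Proof.
move=> Fm; elim: s => [|i s IH].
  by rewrite big_nil; under eq_fun do rewrite big_nil; exact: has_mean_cst.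
rewrite big_cons; under eq_fun do rewrite big_cons.
by case: (Q i) => //; exact: has_meanD.
Qed.

Lemma has_mean_le f g q r :
  has_mean f q -> has_mean g r -> (forall t, f t <= g t) -> q <= r.
Proof.
move=> [fi fq] [gi gr] fg; rewrite -lee_fin -fq -gr unlock.
by apply: le_integral => // t _; rewrite lee_fin.
Qed.

Lemma has_mean_unique f q r : has_mean f q -> has_mean f r -> q = r.
Proof. by move=> [_ fq] [_]; rewrite fq => -[]. Qed.

Lemma has_mean_bounded f c : measurable_fun setT f ->
  (forall t, `|f t| <= c) -> has_mean f (fine 'E_P[f]%E).
Proof.
move=> mf fc.
have fi : P.-integrable setT (EFin \o f).
  apply: measurable_bounded_integrable => //.
    by rewrite (le_lt_trans (probability_le1 P measurableT))// ltry.
  exists c; split; first exact: num_real.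
  by move=> M cM t _; exact: le_trans (fc t) (ltW cM).
by split=> //; rewrite unlock fineK//; exact: integrable_fin_num.
Qed.

Lemma has_mean_norm_le f g q r :
  has_mean f q -> has_mean g r -> (forall t, `|f t| <= g t) -> `|q| <= r.
Proof.
move=> fq gr fg; rewrite ler_norml lerNl; apply/andP; split.
  have := has_mean_le _ _ _ _ (has_meanB _ _ _ _ (has_mean_cst 0) fq) gr.
  rewrite sub0r; apply => t; rewrite /cst sub0r.
  by rewrite (le_trans _ (fg t))// -normrN ler_norm.
by apply: has_mean_le fq gr _ => t; rewrite (le_trans _ (fg t))// ler_norm.
Qed.

(** Joint linearity in the weight and the demand lets the expectation pass inside. *)
Lemma has_mean_cell_cost h b s n (j : option 'I_n) (p : Omega -> R)
    (v : 'I_n -> Omega -> R) q m :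
  has_mean p q -> (forall k, has_mean (v k) (m k)) ->
  has_mean (fun t => cell_cost h b s j (p t) (v ^~ t)) (cell_cost h b s j q m).
Proof.
move=> pq vm; apply: has_mean_sum => k.
have psq : has_mean (fun t => p t * s) (q * s).
  by under eq_fun do rewrite mulrC; rewrite mulrC; exact: has_meanZ.
by case: ifP => _; apply: has_meanZ; apply: has_meanB => //; apply: has_mean_sum.
Qed.

End Means.

(** * Replacing demands by surely bounded ones *)

Section Clamping.
Context {d : measure_display} {Omega : measurableType d} {R : realType}.
Variable P : probability Omega R.
Implicit Types f g X : Omega -> R.

Lemma ae_eq_expectation f g :
  measurable_fun setT f -> measurable_fun setT g ->
  {ae P, forall t, f t = g t} -> 'E_P[f]%E = 'E_P[g]%E.
Proof.
move=> mf mg fg; rewrite unlock; apply: ae_eq_integral => //;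
  [exact/measurable_EFinP|exact/measurable_EFinP|].
by apply: filterS fg => t /= -> _.
Qed.

(* Clamping to the support turns almost sure bounds into sure ones. *)
Lemma clamped_demand X (zlo mu zhi sigma : R) : measurable_fun setT X ->
  zlo <= zhi -> support_mean_mad P X zlo mu zhi sigma ->
  exists Y, [/\ measurable_fun setT Y, (forall t, zlo <= Y t <= zhi),
    {ae P, forall t, X t = Y t}, has_mean P Y mu &
    exists2 r, r <= sigma & has_mean P (fun t => `|Y t - mu|) r].
Proof.
move=> mX zlohi [PX EX madX].
pose Y t := Num.min (Num.max (X t) zlo) zhi.
have mY : measurable_fun setT Y.
  by apply: measurable_minr => //; exact: measurable_maxr.
have Yz t : zlo <= Y t <= zhi.
  by rewrite le_min le_max ge_min !lexx orbT zlohi orbT.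
have XY : {ae P, forall t, X t = Y t}.
  have mA : measurable (X @^-1` `[zlo, zhi]).
    by rewrite -[X in measurable X]setTI; exact: mX.
  exists (~` (X @^-1` `[zlo, zhi])); split; first exact: measurableC.
    by rewrite probability_setC// PX subee.
  move=> t /= /[swap] XA; apply.
  move: XA; rewrite /= in_itv /= => /andP[lo hi].
  by rewrite /Y (max_idPl lo) (min_idPl hi).
have mad f : measurable_fun setT f -> measurable_fun setT (fun t => `|f t - mu|).
  by move=> mf; apply: measurableT_comp => //; exact: measurable_funB.
have bound t : `|Y t| <= `|zlo| + `|zhi|.
  have /andP[lo hi] := Yz t; have := ler_norm zhi; have := ler_norm (- zlo).
  rewrite normrN => ? ?; have := normr_ge0 zlo; have := normr_ge0 zhi.
  by rewrite ler_norml => ? ?; apply/andP; split; lra.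
exists Y; split => //.
  have := has_mean_bounded P _ _ mY bound.
  by rewrite -(ae_eq_expectation _ _ mX mY XY) EX.
have madY : has_mean P (fun t => `|Y t - mu|) (fine 'E_P[(fun t => `|Y t - mu|%R)]%E).
  apply: (has_mean_bounded P _ (`|zlo| + `|zhi| + `|mu|)); first exact: mad.
  by move=> t; rewrite normr_id (le_trans (ler_normB _ _))// lerD2r.
exists (fine 'E_P[(fun t => `|Y t - mu|%R)]%E) => //.
have [_ EY] := madY; rewrite -lee_fin -EY.
rewrite -(ae_eq_expectation _ _ (mad _ mX) (mad _ mY))//.
by apply: filterS XY => t /= ->.
Qed.

End Clamping.

(** * Bounding the expected cost by the optimal value of (LOP) *)

Lemma measurable_inv_cost {d} {Omega : measurableType d} {R : realType} {n}
    (h b s : R) (X : 'I_n -> Omega -> R) :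
  (forall k, measurable_fun setT (X k)) ->
  measurable_fun setT (fun t => inv_cost h b s (X ^~ t)).
Proof.
move=> mX.
have mS k : measurable_fun setT (fun t => s - \sum_(l < n | (l <= k)%N) X l t).
  apply: measurable_funB => //.
  by under eq_fun do rewrite -big_filter; exact: measurable_sum.
apply: measurable_funD; apply: measurable_funM => //; apply: measurable_sum => k.
  exact: measurable_maxr.
by apply: measurable_maxr => //; exact: measurableT_comp.
Qed.

Lemma measurable_in_cell {d} {Omega : measurableType d} {R : realType} {n}
    (s : R) (X : 'I_n -> Omega -> R) j :
  (forall k, measurable_fun setT (X k)) ->
  measurable_fun setT (fun t => (in_cell s (X ^~ t) j)%:R%R : R).
Proof.
move=> mX.
have mS (Q : pred 'I_n) : measurable_fun setT (fun t => \sum_(l < n | Q l) X l t).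
  by under eq_fun do rewrite -big_filter; exact: measurable_sum.
under eq_fun do rewrite /in_cell -mulnb natrM.
have natE (c : bool) : c%:R = (if c then 1 else 0) :> R by case: c.
apply: measurable_funM; under eq_fun do rewrite natE; apply: measurable_fun_ifT => //.
  exact: measurable_fun_ler.
by case: j => [j|//]; exact: measurable_fun_ltr.
Qed.

Lemma expected_cost_le_lop {d} {Omega : measurableType d} {R : realType}
    (P : probability Omega R) {N T : nat}
    {zlo mu zhi sigma : 'I_N -> 'I_T -> R} {h b : R} {i : 'I_N} {t1 t2 : 'I_T}
    {s : R} (pi : option 'I_(interval_length t1 t2) -> R) lambda
    (X : 'I_(interval_length t1 t2) -> Omega -> R) :
  0 <= s -> (forall t, 0 <= zlo i t <= zhi i t) ->
  (forall k, measurable_fun setT (X k)) ->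
  (forall k : 'I_(interval_length t1 t2), let t := period t1 k in
     support_mean_mad P (X k) (zlo i t) (mu i t) (zhi i t) (sigma i t)) ->
  lop_optimal zlo mu zhi sigma h b i s pi lambda ->
  ('E_P[(fun w => inv_cost h b s (X ^~ w))] <= (lop_objective h b s pi lambda)%:E)%E.
Proof.
move=> s0 z0 mX XP [_ opt].
have zlohi t : zlo i t <= zhi i t by case/andP: (z0 t).
have /choice[Y YP] := fun k => clamped_demand P _ _ _ _ _ (mX k) (zlohi _) (XP k).
have mY k : measurable_fun setT (Y k) by case: (YP k).
have Yz (k : 'I__) w : zlo i (period t1 k) <= Y k w <= zhi i (period t1 k).
  by case: (YP k).
have Ymu k : has_mean P (Y k) (mu i (period t1 k)) by case: (YP k).
have Y0 w (k : 'I__) : 0 <= Y k w.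
  have /andP[lo _] := Yz k w.
  by have /andP[zlo0 _] := z0 (period t1 k); exact: le_trans lo.
(* From here on the clamped demands [Y] replace [X]: they are nonnegative at every outcome, so the
   cells partition the whole space. *)
have -> : 'E_P[(fun w => inv_cost h b s (X ^~ w))]%E
        = 'E_P[(fun w => inv_cost h b s (Y ^~ w))]%E.
  apply: ae_eq_expectation; [exact: measurable_inv_cost..|].
  have : \forall w \near almost_everywhere P, forall k, X k w = Y k w.
    by apply: filter_forall => k; case: (YP k).
  by apply: filterS => w XY; congr inv_cost; apply/funext.
pose c j w : R := (in_cell s (Y ^~ w) j)%:R.
have mc j : measurable_fun setT (c j) by exact: measurable_in_cell.
have c0 j w : 0 <= c j w by exact: ler0n.
have c1 w : \sum_j c j w = 1 by exact: sum_in_cell.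
have cc j w : c j w = 1 /\ in_cell s (Y ^~ w) j \/ c j w = 0.
  by rewrite /c; case: (in_cell _ _ _); [left|right].
(* The candidate for (LOP): cell probabilities and integrals of the demand over cells. Boundedness
   makes them finite, so [fine] loses nothing. *)
pose pi' j := fine 'E_P[c j]%E.
pose lambda' j k := fine 'E_P[(fun w => (c j w * Y k w)%R)]%E.
have pi'P j : has_mean P (c j) (pi' j).
  apply: (has_mean_bounded P _ 1) => // w.
  by case: (cc j w) => [[-> _]|->]; rewrite ?normr1 ?normr0.
have lambda'P j k : has_mean P (fun w => c j w * Y k w) (lambda' j k).
  apply: (has_mean_bounded P _ (zhi i (period t1 k))); first exact: measurable_funM.
  move=> w; have /andP[_ hi] := Yz k w.
  case: (cc j w) => [[-> _]|->]; first by rewrite mul1r ger0_norm.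
  by rewrite mul0r normr0 (le_trans _ hi).
have cZ r j : has_mean P (fun w => c j w * r) (pi' j * r).
  by under eq_fun do rewrite mulrC; rewrite mulrC; exact: has_meanZ.
(* On the cell this is exactness of the linear cost; off the cell both sides vanish by
   homogeneity. *)
have cell_costE j w : cell_cost h b s j (c j w) (fun k => c j w * Y k w)
    = c j w * inv_cost h b s (Y ^~ w).
  transitivity (c j w * cell_cost h b s j 1 (Y ^~ w)).
    by rewrite -cell_costZ mulr1.
  case: (cc j w) => [[_ wj]|->]; last by rewrite !mul0r.
  by rewrite (inv_cost_in_cell _ _ _ _ _ _ wj).
have cost_mean : has_mean P (fun w => inv_cost h b s (Y ^~ w))
    (lop_objective h b s pi' lambda').
  have := has_mean_sum P _ (index_enum _) xpredT _ _
    (fun j => has_mean_cell_cost P h b s _ j _ _ _ _ (pi'P j) (lambda'P j)).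
  rewrite lop_objectiveE; congr has_mean; apply/funext => w.
  by under eq_bigr do rewrite cell_costE; rewrite -mulr_suml c1 mul1r.
have [_ ->] := cost_mean; rewrite lee_fin; apply: opt; split.
- split=> [j|]; first exact: has_mean_le (has_mean_cst P 0) (pi'P j) _.
  apply: has_mean_unique (has_mean_sum P _ _ _ _ _ pi'P) _.
  by under eq_fun do rewrite c1; exact: has_mean_cst.
- move=> k; apply: has_mean_unique (Ymu k).
  have := has_mean_sum P _ (index_enum _) xpredT _ _ (fun j => lambda'P j k).
  by under eq_fun do rewrite -mulr_suml c1 mul1r.
- move=> k; have [_ _ _ _ [r rs Yr]] := YP k; apply: le_trans rs.
  (* The absolute deviation is split over the cells: the expectations of the [a j] sum to [r], and
     each dominates the absolute value of the integral of the signed deviation over its cell. *)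
  pose a j w := c j w * `|Y k w - mu i (period t1 k)|.
  have aP j : has_mean P (a j) (fine 'E_P[a j]%E).
    apply: (has_mean_bounded P _ (zhi i (period t1 k) + `|mu i (period t1 k)|)).
      apply: measurable_funM => //; apply: measurableT_comp => //.
      exact: measurable_funB.
    move=> w; rewrite /a; have /andP[_ hi] := Yz k w.
    have zhi0 : 0 <= zhi i (period t1 k) by exact: le_trans hi.
    case: (cc j w) => [[-> _]|->]; last by rewrite mul0r normr0 addr_ge0.
    by rewrite mul1r normr_id (le_trans (ler_normB _ _))// lerD2r ger0_norm.
  rewrite (_ : r = \sum_j fine 'E_P[a j]%E).
    apply: ler_sum => j _.
    apply: has_mean_norm_le (has_meanB P _ _ _ _ (lambda'P j k) (cZ _ j)) (aP j) _.
    by move=> w; rewrite -mulrBr normrM ger0_norm.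
  apply: has_mean_unique Yr _.
  have := has_mean_sum P _ (index_enum _) xpredT _ _ aP.
  by under eq_fun do rewrite -mulr_suml c1 mul1r.
- move=> k j; apply/andP; split.
    apply: has_mean_le (cZ _ j) (lambda'P j k) _ => w.
    by rewrite ler_wpM2l//; case/andP: (Yz k w).
  apply: has_mean_le (lambda'P j k) (cZ _ j) _ => w.
  by rewrite ler_wpM2l//; case/andP: (Yz k w).
(* The inequalities defining a cell hold on it, both sides vanish off it, and taking means gives the
   stock-out constraints. *)
- have sumP j (Q : pred _) : has_mean P (fun w => \sum_(k < _ | Q k) c j w * Y k w)
      (\sum_(k < _ | Q k) lambda' j k) by exact: has_mean_sum.
  split=> [j|]; first (apply/andP; split).
  + apply: has_mean_le (sumP _ _) (cZ _ _) _ => w.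
    rewrite -mulr_sumr; case: (cc (Some j) w) => [[_ /andP[lo _]]|->].
      by rewrite ler_wpM2l.
    by rewrite !mul0r.
  + apply: has_mean_le (cZ _ _) (sumP _ _) _ => w.
    rewrite -mulr_sumr; case: (cc (Some j) w) => [[_ /andP[_ hi]]|->].
      by rewrite ler_wpM2l// ltW.
    by rewrite !mul0r.
  + apply: has_mean_le (sumP _ _) (cZ _ _) _ => w.
    rewrite -mulr_sumr; case: (cc None w) => [[_ /andP[lo _]]|->].
      by rewrite ler_wpM2l.
    by rewrite !mul0r.
Qed.

(** * Positions and periods of the cyclic interval *)

Lemma interval_length_le {T} (t1 t2 : 'I_T) : (interval_length t1 t2 <= T)%N.
Proof. by rewrite /interval_length; have := ltn_ord t2; case: (ltnP t1 t2); lia. Qed.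

Lemma val_period {T} (t : 'I_T) k : period t k = ((t + k) %% T)%N :> nat.
Proof.
elim: k => [|k IH]; first by rewrite addn0 modn_small.
by rewrite /period iterS /= -/(period t k) IH -addn1 modnDml addn1 addnS.
Qed.

(** J has at most T periods, so it never wraps around onto itself. *)
Lemma period_inj {T} (t1 t2 : 'I_T) :
  injective (fun k : 'I_(interval_length t1 t2) => period t1 k).
Proof.
move=> k l /(congr1 val) /= /eqP; rewrite !val_period eqn_modDl.
have small (m : 'I_(interval_length t1 t2)) : (m < T)%N.
  exact: leq_trans (interval_length_le t1 t2).
by rewrite !modn_small// => /eqP/val_inj.
Qed.

(** The support is checked only at atoms of nonzero weight: where [pi j = 0] the quotient
    [lambda j k / pi j] is 0 by convention and may lie outside it. *)
Lemma support_mean_mad_mixture {R : realType} {d} {Omega : measurableType d}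
    {I : finType} (P : probability Omega R) (w : I -> R) (x : I -> Omega)
    (X : Omega -> R) (zlo mu zhi sigma : R) :
  (P = (fun A => \sum_j (w j)%:E * \d_(x j) A)%E :> (set Omega -> \bar R)) ->
  (forall f : Omega -> R, measurable_fun setT f ->
     'E_P[f]%E = (\sum_j w j * f (x j))%:E) ->
  measurable_fun setT X -> \sum_j w j = 1 ->
  (forall j, w j != 0 -> zlo <= X (x j) <= zhi) ->
  \sum_j w j * X (x j) = mu -> \sum_j w j * `|X (x j) - mu| <= sigma ->
  support_mean_mad P X zlo mu zhi sigma.
Proof.
move=> PE EP mX w1 supp mean mad; split.
- rewrite PE -w1 -sumEFin; apply: eq_bigr => j _.
  have [->|/supp zX] := eqVneq (w j) 0; first by rewrite mul0e.
  by rewrite diracE mem_set ?mule1//= in_itv.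
- by rewrite EP// mean.
- rewrite EP ?lee_fin//; apply: measurableT_comp => //.
  exact: measurable_funB.
Qed.

(** * The distribution given by an optimal solution of (LOP) *)

Theorem corollary1 (R : realType) (N T : nat)
    (hN : (1 <= N)%N) (hT : (1 <= T)%N)
    (Atemporal : {set 'I_T * 'I_T})
    (h b : R) (hh : 0 <= h) (hb : 0 <= b)
    (zlo mu zhi sigma : 'I_N -> 'I_T -> R)
    (hdata : forall i t, [/\ 0 <= zlo i t, zlo i t < mu i t,
                             mu i t < zhi i t & 0 <= sigma i t])
    (i : 'I_N) (t1 t2 : 'I_T) (ht : (t1, t2) \in Atemporal) (s : nat)
    (pi : option 'I_(interval_length t1 t2) -> R)
    (lambda : option 'I_(interval_length t1 t2) ->
              'I_(interval_length t1 t2) -> R)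
    (hopt : lop_optimal zlo mu zhi sigma h b i s%:R pi lambda) :
  exists Pstar : probability ((interval_length t1 t2).-tuple R) R,
    [/\ Pstar = discrete_distribution pi lambda :> (set _ -> \bar R),
        ambiguity_set_on zlo mu zhi sigma i Pstar
      & ('E_Pstar[(fun x => inv_cost h b s%:R (fun k => tnth x k))]
           = f_inv zlo mu zhi sigma h b i t1 t2 s%:R)%E].
Proof.
have [[[pi0 pi1] mean mad box _] _] := hopt.
pose v j k := lambda j k / pi j.
(* When [pi j = 0], the box constraint forces [lambda j k = 0]. *)
have lambdaE j k : lambda j k = pi j * v j k.
  rewrite /v mulrCA; have [pij|pij] := eqVneq (pi j) 0; last by rewrite divff ?mulr1.
  have := box k j; rewrite pij !mul0r mulr0 => /andP[? ?].
  by apply/eqP; rewrite eq_le; apply/andP.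
have vbox j (k : 'I__) : pi j != 0 ->
    zlo i (period t1 k) <= v j k <= zhi i (period t1 k).
  move=> pij; have pij0 : 0 < pi j by rewrite lt_neqAle eq_sym pij pi0.
  by have := box k j; rewrite lambdaE !ler_pM2l.
have vmean (k : 'I__) : \sum_j pi j * v j k = mu i (period t1 k).
  by rewrite -mean; apply: eq_bigr => j _; rewrite -lambdaE.
have vmad (k : 'I__) :
    \sum_j pi j * `|v j k - mu i (period t1 k)| <= sigma i (period t1 k).
  apply: le_trans (mad k); apply: ler_sum => j _.
  by rewrite lambdaE -mulrBr normrM (ger0_norm (pi0 j)).
pose x j := [tuple v j k | k < interval_length t1 t2].
(* Coordinates outside retailer i and J are put at their means. *)
pose z j i' t := if i' == i then
    if [pick k : 'I_(interval_length t1 t2) | period t1 k == t] is Some k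
    then v j k else mu i' t
  else mu i' t.
have zE j (k : 'I_(interval_length t1 t2)) : z j i (period t1 k) = v j k.
  rewrite /z eqxx; case: pickP => [l /eqP/period_inj ->//|/(_ k)].
  by rewrite eqxx.
have zcase i' t : (i' = i /\ exists k : 'I_(interval_length t1 t2), t = period t1 k)
    \/ forall j, z j i' t = mu i' t.
  rewrite /z; case: eqP => [->|_]; last by right.
  by case: pickP => [k /eqP <-|_]; [left; split=> //; exists k|right].
pose y j : demands R N T := [tuple [tuple z j i' t | t < T] | i' < N].
have demandE j i' t : demand i' t (y j) = z j i' t.
  by rewrite /demand !tnth_mktuple.
have [Pstar [PstarE EPstar]] := finite_mixture _ x pi0 pi1.
(* [Q] extends [Pstar] to all demands: same weights, with atoms [y j] in place of [x j]. *)
have [Q [QE EQ]] := finite_mixture _ y pi0 pi1.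
have mdemand i' t : measurable_fun setT (@demand R N T i' t).
  apply: (measurableT_comp (measurable_tnth t)); exact: measurable_tnth.
exists Pstar; split.
- rewrite PstarE; apply/funext => A; rewrite /discrete_distribution.
  rewrite [RHS]big_mkcond; apply: eq_bigr => j _.
  by case: eqVneq => //= ->; rewrite mul0e.
- move=> k /=; apply: support_mean_mad_mixture PstarE EPstar _ _ _ _ _ => //.
  + exact: measurable_tnth.
  + by move=> j; rewrite tnth_mktuple; exact: vbox.
  + by under eq_bigr do rewrite tnth_mktuple; exact: vmean.
  + by under eq_bigr do rewrite tnth_mktuple; exact: vmad.
- have Qamb : ambiguity_set zlo mu zhi sigma Q.
    move=> i' t; have [[-> [k ->]]|zmu] := zcase i' t.
      apply: support_mean_mad_mixture QE EQ _ _ _ _ _ => //; first move=> j.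
      + by rewrite demandE zE; exact: vbox.
      + by under eq_bigr do rewrite demandE zE; exact: vmean.
      + by under eq_bigr do rewrite demandE zE; exact: vmad.
    (* The remaining coordinates are constant at their means, which lie in the support and have zero
       deviation. *)
    have [_ /ltW lo /ltW hi sigma0] := hdata i' t.
    apply: support_mean_mad_mixture QE EQ _ _ _ _ _ => //; first move=> j.
    + by rewrite demandE zmu lo.
    + by under eq_bigr do rewrite demandE zmu; rewrite -mulr_suml pi1 mul1r.
    + by rewrite big1// => j _; rewrite demandE zmu subrr normr0 mulr0.
  have EPQ : 'E_Pstar[(fun x => inv_cost h b s%:R (fun k => tnth x k))]%E
      = 'E_Q[(fun u => inv_cost h b s%:R
                (fun k : 'I_(interval_length t1 t2) => demand i (period t1 k) u))]%E.
    rewrite EPstar; last first.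
      by apply: measurable_inv_cost => k; exact: measurable_tnth.
    rewrite EQ; last by apply: measurable_inv_cost => k; exact: mdemand.
    congr EFin; apply: eq_bigr => j _; congr (_ * inv_cost _ _ _ _).
    by apply/funext => k; rewrite demandE zE tnth_mktuple.
  (* [Q] witnesses that the expectation is at most the supremum; conversely the optimal value of
     (LOP) separates every expected cost from the one under [Pstar]. *)
  apply/eqP; rewrite eq_le; apply/andP; split.
    by rewrite EPQ; apply: ereal_sup_ubound; exists Q.
  apply: ge_ereal_sup => _ [P Pamb <-].
  apply: (@le_trans _ _ (lop_objective h b s%:R pi lambda)%:E).
    apply: (expected_cost_le_lop P pi lambda (fun k => demand i (period t1 k))
      (ler0n R s) _ _ _ hopt) => [t|k|k]; [|exact: mdemand|exact: Pamb].
    by have [-> /ltW lo /ltW hi _] := hdata i t; exact: le_trans hi.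
  rewrite EPstar; last by apply: measurable_inv_cost => k; exact: measurable_tnth.
  rewrite lee_fin lop_objectiveE; apply: ler_sum => j _.
  (* Homogeneity turns the objective term of index [j] into [pi j] times the linear cost at the atom
     [v j], which the true cost dominates. *)
  rewrite (_ : cell_cost _ _ _ _ _ _ = pi j * cell_cost h b s%:R j 1 (v j)).
    rewrite ler_wpM2l// (le_trans (cell_cost_le_inv_cost _ _ _ _ _ hh hb))//.
    rewrite (_ : (fun k => tnth (x j) k) = v j)//.
    by apply/funext => k; rewrite tnth_mktuple.
  by rewrite -cell_costZ mulr1; congr cell_cost; apply/funext => k.
Qed.
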